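(* Let $\mathcal{C}$ be a small category and let $\mathsf u:\dot{\mathsf U}\to\mathsf U$ be a natural model of type theory over $\mathcal{C}$, i.e. a representable natural transformation in $\widehat{\mathcal{C}}=[\mathcal{C}^{\mathrm{op}},\mathrm{Set}]$. Then $\mathsf u$ satisfies the rules for intensional identity types if and only if $\mathsf u$ models the (intensional) identity type former, that is: there are maps $\mathsf i:\dot{\mathsf U}\to\dot{\mathsf U}$ and $\mathsf{Id}:\dot{\mathsf U}\times_{\mathsf U}\dot{\mathsf U}\to\mathsf U$ with $\mathsf u\circ\mathsf i=\mathsf{Id}\circ\delta$ (where $\delta:\dot{\mathsf U}\to\dot{\mathsf U}\times_{\mathsf U}\dot{\mathsf U}$ is the diagonal), together with a weak pullback structure $\mathsf J$ for the resulting comparison square $$P_q\dot{\mathsf U}\xrightarrow{\ \rho^*_{\dot{\mathsf U}}\ }P_{\mathsf u}\dot{\mathsf U}\xrightarrow{\ P_{\mathsf u}\mathsf u\ }P_{\mathsf u}\mathsf U,\qquad P_q\dot{\mathsf U}\xrightarrow{\ P_q\mathsf u\ }P_q\mathsf U\xrightarrow{\ \rho^*_{\mathsf U}\ }P_{\mathsf u}\mathsf U .$$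
   Context: **Representability.** A natural transformation $p:Y\to X$ in $\widehat{\mathcal{C}}$ is representable if for every $C\in\mathcal{C}$ and every $x:\mathsf yC\to X$ the pullback of $p$ along $x$ is representable, i.e. has domain of the form $\mathsf yD$. **Interpretation.** Objects $\Gamma$ of $\mathcal{C}$ are contexts and arrows are substitutions. Types $\Gamma\vdash A$ are maps $A:\mathsf y\Gamma\to\mathsf U$; terms $\Gamma\vdash a:A$ are maps $a:\mathsf y\Gamma\to\dot{\mathsf U}$ with $\mathsf u\circ a=A$; substitution is composition; the extended context $\Gamma,A$ with projection $\Gamma,A\to\Gamma$ is the representing object of the pullback of $\mathsf u$ along $A$. **Rules for intensional identity types.** These are the usual rules, holding for all contexts $\Gamma$ and types $\Gamma\vdash A$ (the ambient context $\Gamma$ is suppressed below), with all operations commuting with substitution in $\Gamma$: - Formation: $x,y:A\vdash\mathsf{Id}_A(x,y)$. - Introduction: $x:A\vdash\mathsf i(x):\mathsf{Id}_A(x,x)$. - Elimination: given a type $C(x,y,z)$ in context $x,y:A,\ z:\mathsf{Id}_A(x,y)$ and a term $x:A\vdash c(x):C(\rho x)$, where $\rho x=(x,x,\mathsf i x)$, there is a term $x,y:A,\ z:\mathsf{Id}_A(x,y)\vdash\mathsf J_c(x,y,z):C(x,y,z)$. - Computation: $x:A\vdash\mathsf J_c(\rho x)=c(x):C(\rho x)$. **Polynomials.** For $p:E\to B$ in $\widehat{\mathcal{C}}$, $P_p:\widehat{\mathcal{C}}\to\widehat{\mathcal{C}}$ is the polynomial endofunctor $P_p=B_!\circ p_*\circ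 E^*$ (pull back along $E\to 1$, push forward along $p$, forget to $\widehat{\mathcal{C}}$); $P_p(X)=\Sigma_{b:B}X^{E_b}$. Maps $Z\to P_p(X)$ correspond naturally to pairs $(f_1:Z\to B,\ f_2:Z\times_BE\to X)$. **Comparison square and weak pullback structure.** Given $(\mathsf i,\mathsf{Id})$ with $\mathsf u\circ\mathsf i=\mathsf{Id}\circ\delta$, let $\mathsf I$ be the pullback of $\mathsf u$ along $\mathsf{Id}$, with projection $\mathsf I\to\dot{\mathsf U}\times_{\mathsf U}\dot{\mathsf U}$; let $\rho:\dot{\mathsf U}\to\mathsf I$ be the map induced by $\delta$ and $\mathsf i$; and let $q:\mathsf I\to\mathsf U$ be the composite $\mathsf I\to\dot{\mathsf U}\times_{\mathsf U}\dot{\mathsf U}\to\mathsf U$, so that $q\rho=\mathsf u$. Restriction along $\rho$ gives a natural transformation $\rho^*:P_q\to P_{\mathsf u}$. The comparison square is its naturality square at $\mathsf u$. A weak pullback structure $\mathsf J$ for it is a section of the induced comparison map $P_q\dot{\mathsf U}\to P_q\mathsf U\times_{P_{\mathsf u}\mathsf U}P_{\mathsf u}\dot{\mathsf U}$. *)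

(* Defs.v *)
From Stdlib Require Import ssreflect FunctionalExtensionality ProofIrrelevance.
From Stdlib Require Import ClassicalEpsilon.

Set Implicit Arguments.
Unset Strict Implicit.
Unset Printing Implicit Defensive.

Record Category := {
  Ob :> Type;
  Hom : Ob -> Ob -> Type;
  idc : forall a, Hom a a;
  comp : forall a b c, Hom b c -> Hom a b -> Hom a c;
  comp_idl : forall a b (f : Hom a b), comp (idc b) f = f;
  comp_idr : forall a b (f : Hom a b), comp f (idc a) = f;
  comp_assoc : forall a b c d (h : Hom c d) (g : Hom b c) (f : Hom a b),
    comp h (comp g f) = comp (comp h g) f
}.
Arguments Hom {_} _ _.
Arguments idc {_} _.

Declare Scope cat_scope.
Delimit Scope cat_scope with cat.
Open Scope cat_scope.

Notation "g '\c' f" := (comp g f) (at level 40, left associativity) : cat_scope.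

Record Psh (C : Category) := {
  psh_ob :> C -> Type;
  restr : forall a b : C, Hom b a -> psh_ob a -> psh_ob b;
  restr_id : forall a (x : psh_ob a), restr (idc a) x = x;
  restr_comp : forall a b c (f : Hom b a) (g : Hom c b) (x : psh_ob a),
    restr (f \c g) x = restr g (restr f x)
}.
Arguments restr {_ _ _ _} _ _.

Notation "x '\r' f" := (restr f x) (at level 40, left associativity) : cat_scope.

Record Nat {C : Category} (F G : Psh C) := {
  nat_ap :> forall a : C, F a -> G a;
  nat_ax : forall (a b : C) (f : Hom b a) (x : F a),
    nat_ap (x \r f) = nat_ap x \r f
}.
Arguments nat_ap {_ _ _} _ _ _.
Arguments nat_ax {_ _ _} _ [_ _] _ _.

Notation "F '⇒' G" := (Nat F G) (at level 70, no associativity) : cat_scope.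

Lemma nat_eq {C : Category} {F G : Psh C} (s t : F ⇒ G) :
  (forall a x, s a x = t a x) -> s = t.
Proof.
case: s t => [s hs] [t ht] /= e.
have E : s = t by do 2 (apply: functional_extensionality_dep => ?); exact: e.
by subst t; rewrite (proof_irrelevance _ hs ht).
Qed.

Definition nid {C : Category} (F : Psh C) : F ⇒ F.
Proof. by exists (fun a x => x). Defined.

Definition ncomp {C : Category} {F G H : Psh C} (t : G ⇒ H) (s : F ⇒ G) :
  F ⇒ H.
Proof.
exists (fun a x => t a (s a x)).
abstract by move=> a b f x; rewrite !nat_ax.
Defined.

Notation "t '∘' s" := (ncomp t s) (at level 40, left associativity) : cat_scope.

Lemma ncompA {C : Category} {F G H K : Psh C}
  (r : H ⇒ K) (t : G ⇒ H) (s : F ⇒ G) : r ∘ (t ∘ s) = r ∘ t ∘ s.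
Proof. exact: nat_eq. Qed.

Definition is_iso {C : Category} {F G : Psh C} (s : F ⇒ G) : Prop :=
  exists t : G ⇒ F, t ∘ s = nid F /\ s ∘ t = nid G.

Definition y {C : Category} (a : C) : Psh C.
Proof.
exists (fun b => Hom b a) (fun b c f g => g \c f).
- abstract by move=> b x; exact: comp_idr.
- abstract by move=> b c d f g x; exact: comp_assoc.
Defined.

Definition yon {C : Category} {F : Psh C} {a : C} (x : F a) : y a ⇒ F.
Proof.
exists (fun b (f : Hom b a) => x \r f).
abstract by move=> b c g f; exact: restr_comp.
Defined.

Definition ymap {C : Category} {a b : C} (f : Hom a b) : y a ⇒ y b :=
  @yon C (y b) a f.

Definition unyon {C : Category} {F : Psh C} {a : C} (s : y a ⇒ F) : F a :=
  s a (idc a).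

Lemma unyonK {C : Category} {F : Psh C} {a : C} (s : y a ⇒ F) :
  yon (unyon s) = s.
Proof.
apply: nat_eq => b f; rewrite /= /unyon -nat_ax /=; congr (s b _).
exact: comp_idl.
Qed.

Lemma yonK {C : Category} {F : Psh C} {a : C} (x : F a) : unyon (yon x) = x.
Proof. exact: restr_id. Qed.

Lemma ymap_unyon {C : Category} {a b : C} (s : y a ⇒ y b) :
  ymap (unyon s) = s.
Proof. exact: unyonK. Qed.

Lemma ymap_inj {C : Category} {a b : C} (f g : Hom a b) :
  ymap f = ymap g -> f = g.
Proof.
move=> e; rewrite -(comp_idr f) -(comp_idr g).
exact: (f_equal (fun n : y a ⇒ y b => n a (idc a)) e).
Qed.

Lemma ymap_comp {C : Category} {a b c : C} (g : Hom b c) (f : Hom a b) :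
  ymap (g \c f) = ymap g ∘ ymap f.
Proof. by apply: nat_eq => d h /=; rewrite comp_assoc. Qed.

Lemma ymap_id {C : Category} (a : C) : ymap (idc a) = nid (y a).
Proof. by apply: nat_eq => d h /=; rewrite comp_idl. Qed.

Definition prd {C : Category} (F G : Psh C) : Psh C.
Proof.
exists (fun a => (F a * G a)%type) (fun a b f x => (fst x \r f, snd x \r f)).
- abstract by move=> a [x z]; rewrite !restr_id.
- abstract by move=> a b c f g [x z]; rewrite !restr_comp.
Defined.

Definition prd_fst {C : Category} (F G : Psh C) : prd F G ⇒ F.
Proof. by exists (fun a x => fst x). Defined.

Definition prd_snd {C : Category} (F G : Psh C) : prd F G ⇒ G.
Proof. by exists (fun a x => snd x). Defined.

Definition prd_pair {C : Category} {Z F G : Psh C} (s : Z ⇒ F) (t : Z ⇒ G) :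
  Z ⇒ prd F G.
Proof.
exists (fun a z => (s a z, t a z) : prd F G a).
abstract by move=> a b f z /=; rewrite !nat_ax.
Defined.

Lemma sig_eq {A : Type} {P : A -> Prop} (x z : {a | P a}) :
  proj1_sig x = proj1_sig z -> x = z.
Proof.
case: x z => [x hx] [z hz] /= e; subst z.
by rewrite (proof_irrelevance _ hx hz).
Qed.

Definition pullback {C : Category} {F G H : Psh C} (f : F ⇒ H) (g : G ⇒ H) :
  Psh C.
Proof.
unshelve refine {|
  psh_ob a := {x : F a * G a | f a (fst x) = g a (snd x)};
  restr a b h x :=
    exist _ (fst (proj1_sig x) \r h, snd (proj1_sig x) \r h) _ |}.
- abstract by rewrite /= !nat_ax (proj2_sig x).
- abstract by move=> a [[x z] e]; apply: sig_eq; rewrite /= !restr_id.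
- abstract by move=> a b c h k [[x z] e]; apply: sig_eq; rewrite /= !restr_comp.
Defined.

Definition pb_fst {C : Category} {F G H : Psh C} (f : F ⇒ H) (g : G ⇒ H) :
  pullback f g ⇒ F.
Proof. by exists (fun a (x : pullback f g a) => fst (proj1_sig x)). Defined.

Definition pb_snd {C : Category} {F G H : Psh C} (f : F ⇒ H) (g : G ⇒ H) :
  pullback f g ⇒ G.
Proof. by exists (fun a (x : pullback f g a) => snd (proj1_sig x)). Defined.

Lemma pb_comm {C : Category} {F G H : Psh C} (f : F ⇒ H) (g : G ⇒ H) :
  f ∘ pb_fst f g = g ∘ pb_snd f g.
Proof. apply: nat_eq => a x; exact: (proj2_sig x). Qed.

Definition pb_pair {C : Category} {Z F G H : Psh C} {f : F ⇒ H} {g : G ⇒ H}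
  (s : Z ⇒ F) (t : Z ⇒ G) (e : f ∘ s = g ∘ t) : Z ⇒ pullback f g.
Proof.
unshelve refine {| nat_ap a z := exist _ (s a z, t a z) _ : pullback f g a |}.
- abstract exact: (f_equal (fun n : Z ⇒ H => n a z) e).
- abstract by move=> a b h z; apply: sig_eq; rewrite /= !nat_ax.
Defined.

Lemma nat_pb {C : Category} {F G H K : Psh C} {f : F ⇒ H} {g : G ⇒ H}
  (n : pullback f g ⇒ K) (a : C) (x z : pullback f g a) :
  fst (proj1_sig x) = fst (proj1_sig z) ->
  snd (proj1_sig x) = snd (proj1_sig z) -> n a x = n a z.
Proof.
case: x z => [[x1 x2] h] [[z1 z2] h'] /= e1 e2; subst z1 z2.
by rewrite (proof_irrelevance _ h h').
Qed.

Record Over {C : Category} (B : Psh C) := over { dom : Psh C; arr : dom ⇒ B }.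
Arguments over {_ _ _} _.
Arguments dom {_ _} _.
Arguments arr {_ _} _.

Record OverHom {C : Category} {B : Psh C} (X Z : Over B) := {
  ohom :> dom X ⇒ dom Z;
  ohom_tri : arr Z ∘ ohom = arr X
}.
Arguments ohom {_ _ _ _} _.

Lemma ohom_eq {C : Category} {B : Psh C} {X Z : Over B} (s t : OverHom X Z) :
  (forall a x, s a x = t a x) -> s = t.
Proof.
case: s t => [s hs] [t ht] /= e; have E : s = t by exact: nat_eq.
by subst t; rewrite (proof_irrelevance _ hs ht).
Qed.

Definition ocomp {C : Category} {B : Psh C} {X Z W : Over B}
  (t : OverHom Z W) (s : OverHom X Z) : OverHom X W.
Proof. exists (t ∘ s); abstract by rewrite ncompA !ohom_tri. Defined.

Definition pull {C : Category} {E B : Psh C} (p : E ⇒ B) (Z : Over B) :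
  Over E := over (pb_snd (arr Z) p).

Definition pull_map {C : Category} {E B : Psh C} (p : E ⇒ B) {Z W : Over B}
  (h : OverHom Z W) : OverHom (pull p Z) (pull p W).
Proof.
unshelve refine (@Build_OverHom _ _ (pull p Z) (pull p W)
  (pb_pair (s := h ∘ pb_fst (arr Z) p) (t := pb_snd (arr Z) p) _) _).
- abstract by rewrite ncompA ohom_tri pb_comm.
- abstract exact: nat_eq.
Defined.

Definition oy {C : Category} {B : Psh C} {a : C} (b : B a) : Over B :=
  over (yon b).

Definition oymap {C : Category} {B : Psh C} {a c : C} (b : B a) (f : Hom c a) :
  OverHom (oy (b \r f)) (oy b).
Proof.
exists (ymap f); abstract by apply: nat_eq => d g /=; rewrite restr_comp.
Defined.

(** The pushforward [p_*] along [p], right adjoint to the pullback functor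
    [p^* = pull p]: an element of [p_* X] over [b] is a morphism [p^* b -> X]
    over [E], where [b] is seen as an object [y a -> B] of the slice. The
    adjunction is [push_transpose], [push_untranspose] and the lemmas about
    them. *)
Definition push_ob {C : Category} {E B : Psh C} (p : E ⇒ B) (X : Over E)
  (a : C) : Type := {b : B a & OverHom (pull p (oy b)) X}.

Lemma push_ob_eq {C : Category} {E B : Psh C} (p : E ⇒ B) (X : Over E)
  (a : C) (s t : push_ob p X a) :
  projT1 s = projT1 t ->
  (forall c (f : Hom c a) (e : E c) h h',
    projT2 s c (exist _ (f, e) h) = projT2 t c (exist _ (f, e) h')) ->
  s = t.
Proof.
case: s t => [b s] [b' t] /= e; subst b' => H.
have -> // : s = t by apply: ohom_eq => c [[f x] h]; exact: H.
Qed.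

Definition push_restr {C : Category} {E B : Psh C} {p : E ⇒ B} {X : Over E}
  {a c : C} (f : Hom c a) (s : push_ob p X a) : push_ob p X c :=
  existT (fun b => OverHom (pull p (oy b)) X) (projT1 s \r f)
    (ocomp (projT2 s) (pull_map p (oymap (projT1 s) f))).

Lemma push_restr_id {C : Category} {E B : Psh C} {p : E ⇒ B} {X : Over E}
  {a : C} (s : push_ob p X a) : push_restr (idc a) s = s.
Proof.
apply: push_ob_eq; first exact: restr_id.
move=> c f e h h'; apply: (nat_pb (projT2 s)) => //; exact: comp_idl.
Qed.

Lemma push_restr_comp {C : Category} {E B : Psh C} {p : E ⇒ B} {X : Over E}
  {a b c : C} (f : Hom b a) (g : Hom c b) (s : push_ob p X a) :
  push_restr (f \c g) s = push_restr g (push_restr f s).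
Proof.
apply: push_ob_eq; first exact: restr_comp.
move=> d k e h h'; apply: (nat_pb (projT2 s)) => //=.
by rewrite comp_assoc.
Qed.

Definition push_psh {C : Category} {E B : Psh C} (p : E ⇒ B) (X : Over E) :
  Psh C := {|
  psh_ob := push_ob p X;
  restr a c f s := push_restr f s;
  restr_id a s := push_restr_id s;
  restr_comp a b c f g s := push_restr_comp f g s
|}.

Definition push {C : Category} {E B : Psh C} (p : E ⇒ B) (X : Over E) :
  Over B :=
  over (@Build_Nat _ (push_psh p X) B (fun a s => projT1 s)
          (fun a b f s => eq_refl _)).

Definition push_map_ob {C : Category} {E B : Psh C} {p : E ⇒ B}
  {X Z : Over E} (h : OverHom X Z) {a : C} (s : push_ob p X a) :
  push_ob p Z a :=
  existT (fun b => OverHom (pull p (oy b)) Z) (projT1 s) (ocomp h (projT2 s)).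

Definition push_map {C : Category} {E B : Psh C} (p : E ⇒ B) {X Z : Over E}
  (h : OverHom X Z) : OverHom (push p X) (push p Z).
Proof.
unshelve refine (@Build_OverHom _ _ (push p X) (push p Z)
  (@Build_Nat _ (push_psh p X) (push_psh p Z) (fun a s => push_map_ob h s)
     _) _).
- abstract by move=> a c f s; apply: push_ob_eq => // d g x k k';
    congr (h d _); apply: (nat_pb (projT2 s)).
- abstract exact: nat_eq.
Defined.

Lemma yon_tri {C : Category} {B : Psh C} (Z : Over B) {a : C} (z : dom Z a) :
  arr Z ∘ yon z = yon (arr Z a z).
Proof. apply: nat_eq => c f; exact: nat_ax. Qed.

Definition oyon {C : Category} {B : Psh C} {Z : Over B} {a : C}
  (z : dom Z a) : OverHom (oy (arr Z a z)) Z :=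
  @Build_OverHom _ _ (oy (arr Z a z)) Z (yon z) (yon_tri z).

Definition push_transpose {C : Category} {E B : Psh C} {p : E ⇒ B}
  {Z : Over B} {X : Over E} (h : OverHom (pull p Z) X) : OverHom Z (push p X).
Proof.
unshelve refine (@Build_OverHom _ _ Z (push p X)
  (@Build_Nat _ (dom Z) (push_psh p X) (fun a z =>
    existT (fun b => OverHom (pull p (oy b)) X) (arr Z a z)
      (ocomp h (pull_map p (oyon z)))) _) _).
- abstract by move=> a b f z; apply: push_ob_eq; [exact: nat_ax|];
    move=> c g e k k'; apply: (nat_pb h) => //=; rewrite restr_comp.
- abstract exact: nat_eq.
Defined.

Lemma push_tri {C : Category} {E B : Psh C} {p : E ⇒ B} {Z : Over B}
  {X : Over E} (k : OverHom Z (push p X)) (a : C) (z : dom Z a) :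
  projT1 (k a z) = arr Z a z.
Proof. exact: (f_equal (fun n : dom Z ⇒ B => n a z) (ohom_tri k)). Qed.

Lemma push_at_pf {C : Category} {E B : Psh C} {p : E ⇒ B} {X : Over E}
  {a b c : C} {f : Hom b a} {s : push_ob p X b} {t : push_ob p X a} :
  s = push_restr f t -> forall (g : Hom c b) (e : E c),
  projT1 s \r g = p c e -> projT1 t \r (f \c g) = p c e.
Proof. by move=> -> g e <-; exact: restr_comp. Qed.

Lemma push_at {C : Category} {E B : Psh C} {p : E ⇒ B} {X : Over E}
  {a b c : C} {f : Hom b a} {s : push_ob p X b} {t : push_ob p X a}
  (h : s = push_restr f t) (g : Hom c b) (e : E c)
  (hs : projT1 s \r g = p c e) :
  projT2 s c (exist _ (g, e) hs)
    = projT2 t c (exist _ (f \c g, e) (push_at_pf h hs)).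
Proof.
move: (push_at_pf h hs) => h'; subst s.
exact: (nat_pb (projT2 t)).
Qed.

Lemma push_untranspose_pf {C : Category} {E B : Psh C} {p : E ⇒ B}
  {Z : Over B} {X : Over E} (k : OverHom Z (push p X)) (a : C)
  (w : pullback (arr Z) p a) :
  projT1 (k a (fst (proj1_sig w))) \r idc a = p a (snd (proj1_sig w)).
Proof. by rewrite restr_id push_tri (proj2_sig w). Qed.

Definition push_untranspose {C : Category} {E B : Psh C} {p : E ⇒ B}
  {Z : Over B} {X : Over E} (k : OverHom Z (push p X)) : OverHom (pull p Z) X.
Proof.
unshelve refine (@Build_OverHom _ _ (pull p Z) X
  (@Build_Nat _ (pullback (arr Z) p) (dom X) (fun a w =>
    projT2 (k a (fst (proj1_sig w))) a
      (exist _ (idc a, snd (proj1_sig w)) (push_untranspose_pf k w))) _) _).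
- abstract (move=> a b f w; rewrite -nat_ax;
    apply: eq_trans (push_at (nat_ax k f (fst (proj1_sig w))) _) _;
    apply: (nat_pb (projT2 (k a _))) => //=; by rewrite comp_idl comp_idr).
- abstract (apply: nat_eq => a w;
    exact: (f_equal (fun n : dom (pull p (oy (projT1 (k a _)))) ⇒ E => n a _)
           (ohom_tri (projT2 (k a (fst (proj1_sig w))))))).
Defined.

Lemma push_transposeK {C : Category} {E B : Psh C} {p : E ⇒ B}
  {Z : Over B} {X : Over E} (h : OverHom (pull p Z) X) :
  push_untranspose (push_transpose h) = h.
Proof.
apply: ohom_eq => a w; apply: (nat_pb h) => //; exact: restr_id.
Qed.

Lemma push_untransposeK {C : Category} {E B : Psh C} {p : E ⇒ B}
  {Z : Over B} {X : Over E} (k : OverHom Z (push p X)) :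
  push_transpose (push_untranspose k) = k.
Proof.
apply: ohom_eq => a z; apply: push_ob_eq; first exact: eq_sym (push_tri k z).
move=> c f e h h'; rewrite /=.
apply: eq_trans (push_at (nat_ax k f z) _) _.
apply: (nat_pb (projT2 (k a z))) => //=; exact: comp_idr.
Qed.

Lemma push_transpose_natl {C : Category} {E B : Psh C} {p : E ⇒ B}
  {W Z : Over B} {X : Over E} (h : OverHom (pull p Z) X) (g : OverHom W Z) :
  push_transpose (ocomp h (pull_map p g)) = ocomp (push_transpose h) g.
Proof.
apply: ohom_eq => a w; apply: push_ob_eq.
  by rewrite /= -(ohom_tri g).
move=> c f e k k'; apply: (nat_pb h) => //; exact: nat_ax.
Qed.

Lemma push_transpose_natr {C : Category} {E B : Psh C} {p : E ⇒ B}
  {Z : Over B} {X X' : Over E} (h : OverHom (pull p Z) X) (g : OverHom X X') :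
  push_transpose (ocomp g h) = ocomp (push_map p g) (push_transpose h).
Proof.
apply: ohom_eq => a z; apply: push_ob_eq => // c f e k k'.
congr (g c _); exact: (nat_pb h).
Qed.

Definition cart {C : Category} (E X : Psh C) : Over E := over (prd_fst E X).

Definition cart_map {C : Category} (E : Psh C) {X Z : Psh C} (f : X ⇒ Z) :
  OverHom (cart E X) (cart E Z).
Proof.
exists (prd_pair (prd_fst E X) (f ∘ prd_snd E X)); abstract exact: nat_eq.
Defined.

(** [P_p = B_! p_* E^*], where [E^* = cart E] and the forgetful [B_!] is [dom]
    on objects and [ohom] on morphisms. *)
Definition poly {C : Category} {E B : Psh C} (p : E ⇒ B) (X : Psh C) :
  Psh C := dom (push p (cart E X)).

Definition poly_map {C : Category} {E B : Psh C} (p : E ⇒ B) {X Z : Psh C}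
  (f : X ⇒ Z) : poly p X ⇒ poly p Z := ohom (push_map p (cart_map E f)).

(** For [rho : E -> F] over [B], the family [x_(e : F_b)] is sent to
    [x_(rho e : F_b)] indexed by [e : E_b]. *)
Definition fibre_map {C : Category} {E F B : Psh C} {p : E ⇒ B} {q : F ⇒ B}
  (rho : E ⇒ F) (e : q ∘ rho = p) (Z : Over B) :
  dom (pull p Z) ⇒ dom (pull q Z).
Proof.
apply: (pb_pair (s := pb_fst (arr Z) p) (t := rho ∘ pb_snd (arr Z) p)).
abstract by rewrite ncompA e pb_comm.
Defined.

Definition restrict_family {C : Category} {E F B X : Psh C} {p : E ⇒ B}
  {q : F ⇒ B} (rho : E ⇒ F) (e : q ∘ rho = p) (Z : Over B)
  (s : OverHom (pull q Z) (cart F X)) : OverHom (pull p Z) (cart E X).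
Proof.
exists (prd_pair (arr (pull p Z)) (prd_snd F X ∘ s ∘ fibre_map e Z)).
abstract exact: nat_eq.
Defined.

Definition poly_restrict_ob {C : Category} {E F B : Psh C} {p : E ⇒ B}
  {q : F ⇒ B} (rho : E ⇒ F) (e : q ∘ rho = p) {X : Psh C} {a : C}
  (s : poly q X a) : poly p X a :=
  existT (fun b => OverHom (pull p (oy b)) (cart E X)) (projT1 s)
    (restrict_family e (projT2 s)).

Definition poly_restrict {C : Category} {E F B : Psh C} {p : E ⇒ B}
  {q : F ⇒ B} (rho : E ⇒ F) (e : q ∘ rho = p) (X : Psh C) :
  poly q X ⇒ poly p X.
Proof.
unshelve refine (@Build_Nat _ (poly q X) (poly p X)
  (fun a s => poly_restrict_ob e s) _).
abstract (move=> a c f s; apply: push_ob_eq => // d g x h h';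
  apply: (f_equal2 (@pair _ _)) => //; apply: (f_equal snd);
  exact: (nat_pb (projT2 s))).
Defined.

Lemma poly_restrict_nat {C : Category} {E F B : Psh C} {p : E ⇒ B}
  {q : F ⇒ B} (rho : E ⇒ F) (e : q ∘ rho = p) {X Z : Psh C} (f : X ⇒ Z) :
  poly_restrict e Z ∘ poly_map q f = poly_map p f ∘ poly_restrict e X.
Proof.
apply: nat_eq => a s; apply: push_ob_eq => // c g x h h'.
apply: (f_equal2 (@pair _ _)) => //; apply: (f_equal (f c)).
apply: (f_equal snd); exact: (nat_pb (projT2 s)).
Qed.

Definition representable_psh {C : Category} (F : Psh C) : Prop :=
  exists (D : C) (s : y D ⇒ F), is_iso s.

Definition representable {C : Category} {Y X : Psh C} (p : Y ⇒ X) : Prop :=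
  forall (G : C) (x : y G ⇒ X), representable_psh (pullback x p).

(** Representability of [u] only asserts that the extended contexts [G,A]
    exist; a [context_extension] selects one, with its isomorphism, for each [G]
    and [A]. *)
Record extension {C : Category} {Ud U : Psh C} (u : Ud ⇒ U) {G : C}
  (A : y G ⇒ U) := {
  ext_ob : C;
  ext_to : y ext_ob ⇒ pullback A u;
  ext_from : pullback A u ⇒ y ext_ob;
  ext_toK : ext_from ∘ ext_to = nid (y ext_ob);
  ext_fromK : ext_to ∘ ext_from = nid (pullback A u)
}.

Definition context_extension {C : Category} {Ud U : Psh C} (u : Ud ⇒ U) :=
  forall (G : C) (A : y G ⇒ U), extension u A.

Lemma context_extension_exists {C : Category} {Ud U : Psh C} (u : Ud ⇒ U) :
  representable u -> inhabited (context_extension u).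
Proof.
move=> hu; constructor => G A.
have [D HD] := constructive_indefinite_description _ (hu G A).
have [s Hs] := constructive_indefinite_description _ HD.
have [t [ts st]] := constructive_indefinite_description _ Hs.
exact: Build_extension ts st.
Qed.

Definition Ty {C : Category} (U : Psh C) (G : C) := y G ⇒ U.

Record Tm {C : Category} {Ud U : Psh C} (u : Ud ⇒ U) {G : C} (A : Ty U G) := {
  tm :> y G ⇒ Ud;
  tm_ty : u ∘ tm = A
}.

Definition ty_sub {C : Category} {U : Psh C} {D G : C} (A : Ty U G)
  (s : Hom D G) : Ty U D := A ∘ ymap s.

Notation "A '.[' s ']'" := (ty_sub A s)
  (at level 1, left associativity, format "A .[ s ]") : cat_scope.

Lemma ty_sub_comp {C : Category} {U : Psh C} {K D G : C} (A : Ty U G)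
  (s : Hom D G) (t : Hom K D) : A.[s].[t] = A.[s \c t].
Proof. by rewrite /ty_sub ymap_comp ncompA. Qed.

Lemma ty_sub_id {C : Category} {U : Psh C} {G : C} (A : Ty U G) :
  A.[idc G] = A.
Proof. by apply: nat_eq => a f /=; rewrite comp_idl. Qed.

Definition tm_cast {C : Category} {Ud U : Psh C} {u : Ud ⇒ U} {G : C}
  {A B : Ty U G} (e : A = B) (a : Tm u A) : Tm u B :=
  {| tm := a; tm_ty := eq_trans (tm_ty a) e |}.

Definition tm_sub {C : Category} {Ud U : Psh C} {u : Ud ⇒ U} {D G : C}
  {A : Ty U G} (a : Tm u A) (s : Hom D G) : Tm u A.[s].
Proof. exists (tm a ∘ ymap s); abstract by rewrite ncompA tm_ty. Defined.

Definition ext {C : Category} {Ud U : Psh C} {u : Ud ⇒ U}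
  (X : context_extension u) (G : C) (A : Ty U G) : C := ext_ob (X G A).

Definition proj {C : Category} {Ud U : Psh C} {u : Ud ⇒ U}
  (X : context_extension u) {G : C} (A : Ty U G) : Hom (ext X A) G :=
  unyon (pb_fst A u ∘ ext_to (X G A)).

Definition var {C : Category} {Ud U : Psh C} {u : Ud ⇒ U}
  (X : context_extension u) {G : C} (A : Ty U G) : Tm u A.[proj X A].
Proof.
exists (pb_snd A u ∘ ext_to (X G A)).
abstract by rewrite /ty_sub /proj ymap_unyon ncompA -pb_comm -ncompA.
Defined.

(** [sub_pair s a = (s, a) : D -> G,A] for [s : D -> G] and [D |- a : A[s]]. *)
Definition sub_pair {C : Category} {Ud U : Psh C} {u : Ud ⇒ U}
  (X : context_extension u) {D G : C} {A : Ty U G} (s : Hom D G)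
  (a : Tm u A.[s]) : Hom D (ext X A) :=
  unyon (ext_from (X G A) ∘ pb_pair (eq_sym (tm_ty a))).

Lemma ymap_sub_pair {C : Category} {Ud U : Psh C} {u : Ud ⇒ U}
  (X : context_extension u) {D G : C} {A : Ty U G} (s : Hom D G)
  (a : Tm u A.[s]) :
  ext_to (X G A) ∘ ymap (sub_pair X a) = pb_pair (eq_sym (tm_ty a)).
Proof.
rewrite /sub_pair ymap_unyon ncompA ext_fromK; exact: nat_eq.
Qed.

Lemma proj_sub_pair {C : Category} {Ud U : Psh C} {u : Ud ⇒ U}
  (X : context_extension u) {D G : C} {A : Ty U G} (s : Hom D G)
  (a : Tm u A.[s]) : proj X A \c sub_pair X a = s.
Proof.
apply: ymap_inj; rewrite ymap_comp /proj ymap_unyon -ncompA ymap_sub_pair.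
exact: nat_eq.
Qed.

Lemma var_sub_pair {C : Category} {Ud U : Psh C} {u : Ud ⇒ U}
  (X : context_extension u) {D G : C} {A : Ty U G} (s : Hom D G)
  (a : Tm u A.[s]) : tm (var X A) ∘ ymap (sub_pair X a) = tm a.
Proof. rewrite /= -ncompA ymap_sub_pair; exact: nat_eq. Qed.

Lemma ext_hom_eq {C : Category} {Ud U : Psh C} {u : Ud ⇒ U}
  (X : context_extension u) {D G : C} {A : Ty U G} (f g : Hom D (ext X A)) :
  proj X A \c f = proj X A \c g ->
  tm (var X A) ∘ ymap f = tm (var X A) ∘ ymap g -> f = g.
Proof.
move=> e1 e2; apply: ymap_inj.
have K (n : y D ⇒ y (ext X A)) :
    n = ext_from (X G A) ∘ (ext_to (X G A) ∘ n).
  by rewrite ncompA ext_toK; exact: nat_eq.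
rewrite (K (ymap f)) (K (ymap g)); congr (_ ∘ _); apply: nat_eq => a h.
apply: sig_eq; rewrite [LHS]surjective_pairing [RHS]surjective_pairing.
have e1' : pb_fst A u ∘ ext_to (X G A) ∘ ymap f
         = pb_fst A u ∘ ext_to (X G A) ∘ ymap g.
  by rewrite -(ymap_unyon (pb_fst A u ∘ ext_to (X G A))) -!ymap_comp;
     exact: (f_equal ymap e1).
apply: (f_equal2 (@pair _ _)).
- exact: (f_equal (fun n : y D ⇒ y G => n a h) e1').
- exact: (f_equal (fun n : y D ⇒ Ud => n a h) e2).
Qed.

(** The weakening [s,B : D,B -> G,A] of [s : D -> G], where [B] is [A[s]]; the
    equation is an argument because the types to which this is applied agree
    with [A[s]] only propositionally. *)
Definition lift {C : Category} {Ud U : Psh C} {u : Ud ⇒ U}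
  (X : context_extension u) {D G : C} (s : Hom D G) {A : Ty U G} {B : Ty U D}
  (e : B = A.[s]) : Hom (ext X B) (ext X A).
Proof.
apply: (sub_pair (s := s \c proj X B) X); apply: (tm_cast _ (var X B)).
abstract by rewrite e ty_sub_comp.
Defined.

Lemma proj_lift {C : Category} {Ud U : Psh C} {u : Ud ⇒ U}
  (X : context_extension u) {D G : C} (s : Hom D G) {A : Ty U G} {B : Ty U D}
  (e : B = A.[s]) : proj X A \c lift X e = s \c proj X B.
Proof. exact: proj_sub_pair. Qed.

Lemma var_lift {C : Category} {Ud U : Psh C} {u : Ud ⇒ U}
  (X : context_extension u) {D G : C} (s : Hom D G) {A : Ty U G} {B : Ty U D}
  (e : B = A.[s]) : tm (var X A) ∘ ymap (lift X e) = tm (var X B).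
Proof. exact: var_sub_pair. Qed.

(** The context [G, x y : A]. *)
Definition ext2 {C : Category} {Ud U : Psh C} {u : Ud ⇒ U}
  (X : context_extension u) {G : C} (A : Ty U G) : C :=
  ext X A.[proj X A].

Definition lift1 {C : Category} {Ud U : Psh C} {u : Ud ⇒ U}
  (X : context_extension u) {D G : C} (s : Hom D G) (A : Ty U G) :
  Hom (ext X A.[s]) (ext X A) := lift X (eq_refl A.[s]).

Lemma lift2_ty {C : Category} {Ud U : Psh C} {u : Ud ⇒ U}
  (X : context_extension u) {D G : C} (s : Hom D G) (A : Ty U G) :
  A.[s].[proj X A.[s]] = A.[proj X A].[lift1 X s A].
Proof. by rewrite !ty_sub_comp proj_lift. Qed.

Definition lift2 {C : Category} {Ud U : Psh C} {u : Ud ⇒ U}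
  (X : context_extension u) {D G : C} (s : Hom D G) (A : Ty U G) :
  Hom (ext2 X A.[s]) (ext2 X A) := lift X (lift2_ty X s A).

(** The substitution [(x, x) : (G, x : A) -> (G, x y : A)]. *)
Definition diag {C : Category} {Ud U : Psh C} {u : Ud ⇒ U}
  (X : context_extension u) {G : C} (A : Ty U G) : Hom (ext X A) (ext2 X A).
Proof.
apply: (sub_pair (s := idc (ext X A)) X); apply: (tm_cast _ (var X A)).
abstract by rewrite ty_sub_id.
Defined.

Record Id_formation {C : Category} {Ud U : Psh C} {u : Ud ⇒ U}
  (X : context_extension u) := {
  Idt : forall (G : C) (A : Ty U G), Ty U (ext2 X A);
  Idt_sub : forall (D G : C) (s : Hom D G) (A : Ty U G),
    Idt A.[s] = (Idt A).[lift2 X s A]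
}.
Arguments Idt {_ _ _ _ _} _ [_] _.
Arguments Idt_sub {_ _ _ _ _} _ [_ _] _ _.

Record Id_introduction {C : Category} {Ud U : Psh C} {u : Ud ⇒ U}
  {X : context_extension u} (F : Id_formation X) := {
  refl : forall (G : C) (A : Ty U G), Tm u (Idt F A).[diag X A];
  refl_sub : forall (D G : C) (s : Hom D G) (A : Ty U G),
    tm (refl A.[s]) = tm (refl A) ∘ ymap (lift1 X s A)
}.
Arguments refl {_ _ _ _ _ _} _ [_] _.

(** The context [G, x y : A, z : Id_A(x,y)]. *)
Definition ext3 {C : Category} {Ud U : Psh C} {u : Ud ⇒ U}
  {X : context_extension u} (F : Id_formation X) {G : C} (A : Ty U G) : C :=
  ext X (Idt F A).

Definition lift3 {C : Category} {Ud U : Psh C} {u : Ud ⇒ U}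
  {X : context_extension u} (F : Id_formation X) {D G : C} (s : Hom D G)
  (A : Ty U G) : Hom (ext3 F A.[s]) (ext3 F A) := lift X (Idt_sub F s A).

(** The substitution [(x, x, i x) : (G, x : A) -> (G, x y : A, z : Id_A(x,y))]. *)
Definition rho_sub {C : Category} {Ud U : Psh C} {u : Ud ⇒ U}
  {X : context_extension u} {F : Id_formation X} (I : Id_introduction F)
  {G : C} (A : Ty U G) : Hom (ext X A) (ext3 F A) := sub_pair X (refl I A).

Lemma proj_diag {C : Category} {Ud U : Psh C} {u : Ud ⇒ U}
  (X : context_extension u) {G : C} (A : Ty U G) :
  proj X A.[proj X A] \c diag X A = idc _.
Proof. exact: proj_sub_pair. Qed.

Lemma var_diag {C : Category} {Ud U : Psh C} {u : Ud ⇒ U}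
  (X : context_extension u) {G : C} (A : Ty U G) :
  tm (var X A.[proj X A]) ∘ ymap (diag X A) = tm (var X A).
Proof. exact: var_sub_pair. Qed.

Lemma lift2_diag {C : Category} {Ud U : Psh C} {u : Ud ⇒ U}
  (X : context_extension u) {D G : C} (s : Hom D G) (A : Ty U G) :
  lift2 X s A \c diag X A.[s] = diag X A \c lift1 X s A.
Proof.
apply: ext_hom_eq.
  rewrite !comp_assoc proj_lift proj_diag -comp_assoc proj_diag.
  by rewrite comp_idl comp_idr.
by rewrite !ymap_comp !ncompA var_lift !var_diag var_lift.
Qed.

Lemma proj_rho_sub {C : Category} {Ud U : Psh C} {u : Ud ⇒ U}
  {X : context_extension u} {F : Id_formation X} (I : Id_introduction F)
  {G : C} (A : Ty U G) : proj X (Idt F A) \c rho_sub I A = diag X A.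
Proof. exact: proj_sub_pair. Qed.

Lemma var_rho_sub {C : Category} {Ud U : Psh C} {u : Ud ⇒ U}
  {X : context_extension u} {F : Id_formation X} (I : Id_introduction F)
  {G : C} (A : Ty U G) :
  tm (var X (Idt F A)) ∘ ymap (rho_sub I A) = tm (refl I A).
Proof. exact: var_sub_pair. Qed.

Lemma lift3_rho {C : Category} {Ud U : Psh C} {u : Ud ⇒ U}
  {X : context_extension u} {F : Id_formation X} (I : Id_introduction F)
  {D G : C} (s : Hom D G) (A : Ty U G) :
  lift3 F s A \c rho_sub I A.[s] = rho_sub I A \c lift1 X s A.
Proof.
apply: ext_hom_eq.
  by rewrite !comp_assoc proj_lift proj_rho_sub -comp_assoc proj_rho_sub
    lift2_diag.
by rewrite !ymap_comp !ncompA var_lift !var_rho_sub refl_sub.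
Qed.

Definition premise_sub {C : Category} {Ud U : Psh C} {u : Ud ⇒ U}
  {X : context_extension u} {F : Id_formation X} (I : Id_introduction F)
  {D G : C} (s : Hom D G) {A : Ty U G} {K : Ty U (ext3 F A)}
  (c : Tm u K.[rho_sub I A]) : Tm u K.[lift3 F s A].[rho_sub I A.[s]].
Proof.
apply: (tm_cast _ (tm_sub c (lift1 X s A))).
abstract by rewrite !ty_sub_comp lift3_rho.
Defined.

Record Id_elimination {C : Category} {Ud U : Psh C} {u : Ud ⇒ U}
  {X : context_extension u} {F : Id_formation X} (I : Id_introduction F) := {
  J : forall (G : C) (A : Ty U G) (K : Ty U (ext3 F A)),
    Tm u K.[rho_sub I A] -> Tm u K;
  J_comp : forall (G : C) (A : Ty U G) (K : Ty U (ext3 F A))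
    (c : Tm u K.[rho_sub I A]), tm (J c) ∘ ymap (rho_sub I A) = tm c;
  J_sub : forall (D G : C) (s : Hom D G) (A : Ty U G) (K : Ty U (ext3 F A))
    (c : Tm u K.[rho_sub I A]),
    tm (J (premise_sub s c)) = tm (J c) ∘ ymap (lift3 F s A)
}.

Definition satisfies_Id_rules {C : Category} {Ud U : Psh C} (u : Ud ⇒ U)
  (X : context_extension u) : Prop :=
  exists (F : Id_formation X) (I : Id_introduction F),
    inhabited (Id_elimination I).
Arguments satisfies_Id_rules {_ _ _} u X.

Definition diagonal {C : Category} {Ud U : Psh C} (u : Ud ⇒ U) :
  Ud ⇒ pullback u u := pb_pair (eq_refl (u ∘ nid Ud)).

Definition Ipb {C : Category} {Ud U : Psh C} (u : Ud ⇒ U)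
  (Id : pullback u u ⇒ U) : Psh C := pullback Id u.

Definition Iq {C : Category} {Ud U : Psh C} (u : Ud ⇒ U)
  (Id : pullback u u ⇒ U) : Ipb Id ⇒ U :=
  u ∘ pb_fst u u ∘ pb_fst Id u.

Definition Irho {C : Category} {Ud U : Psh C} {u : Ud ⇒ U}
  {i : Ud ⇒ Ud} {Id : pullback u u ⇒ U}
  (e : u ∘ i = Id ∘ diagonal u) : Ud ⇒ Ipb Id := pb_pair (eq_sym e).

Lemma Iq_rho {C : Category} {Ud U : Psh C} {u : Ud ⇒ U}
  {i : Ud ⇒ Ud} {Id : pullback u u ⇒ U}
  (e : u ∘ i = Id ∘ diagonal u) : Iq Id ∘ Irho e = u.
Proof. exact: nat_eq. Qed.

Definition weak_pullback_structure {C : Category} {W X Z B : Psh C}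
  {h : W ⇒ X} {k : W ⇒ Z} {f : X ⇒ B} {g : Z ⇒ B}
  (e : f ∘ h = g ∘ k) : Type :=
  {J : pullback f g ⇒ W | pb_pair e ∘ J = nid (pullback f g)}.

Definition models_Id {C : Category} {Ud U : Psh C} (u : Ud ⇒ U) : Prop :=
  exists (i : Ud ⇒ Ud) (Id : pullback u u ⇒ U)
    (e : u ∘ i = Id ∘ diagonal u),
    inhabited (weak_pullback_structure (poly_restrict_nat (Iq_rho e) u)).

(* Main.v *)
From Stdlib Require Import ssreflect ProofIrrelevance.
Require Import Defs.

Set Implicit Arguments.
Unset Strict Implicit.
Unset Printing Implicit Defensive.

Open Scope cat_scope.

(** The idea is that both sides describe one structure: a choice of diagonal
    fillers, stable under reindexing, for the squares that compare [rho] with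
    [u] fibrewise.

    By the Yoneda lemma an element at [G] of [P_q Ud] is a map
    [A : y G -> U] together with a family [pullback A q -> Ud], and similarly
    for the other three corners of the comparison square. An element of its
    pullback is therefore a type [A] with a commuting square
<<
      pullback A u --c--> Ud
           |              |
        rho|              |u
           v              v
      pullback A q --k--> U
>>
    and a point of [P_q Ud] above it is a diagonal filler of this square. So a
    section of the comparison map, being natural in [G], is exactly a
    [stable_filler]: [stable_filler_of_weak_pullback] and
    [weak_pullback_of_stable_filler]. Up to this point [q], [rho] and [u] may be
    arbitrary.

    On the syntactic side [pullback A u] is represented by [G, x:A] and
    [pullback A q] by [G, x y:A, z:Id_A(x,y)] ([vars3], [vars3_inv]), and under
    these isomorphisms the vertical map on the left is the substitution
    [(x, x, i x)] ([vars3_rho]). Hence [k] is a motive [C], [c] is a term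
    [c(x) : C(x, x, i x)], and a filler is a term [J_c] of [C] with
    [J_c(x, x, i x) = c(x)]; stability of fillers is the commutation of [J]
    with substitution. This gives [stable_filler_of_elimination] and
    [elimination_of_stable_filler], as soon as the formation and introduction
    rules are interpreted by the same data as [Id] and [i], which is what
    [agree] records. Such data correspond because the generic type
    [x, y : A |- Id_A(x,y)], being stable under substitution, is determined by
    its instances at pairs of terms ([Idt_local]), that is, by a natural map
    out of the presheaf [pullback u u] of such pairs: [maps_of_rules] and
    [rules_of_maps]. *)

(** * Natural transformations and pullbacks of presheaves *)

Lemma nat_app {C : Category} {F G : Psh C} {s t : F ⇒ G} (e : s = t) (a : C)
  (x : F a) : s a x = t a x.
Proof. by rewrite e. Qed.

Lemma pb_eq {C : Category} {F G H : Psh C} {f : F ⇒ H} {g : G ⇒ H} {a : C}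
  (x z : pullback f g a) :
  pb_fst f g a x = pb_fst f g a z -> pb_snd f g a x = pb_snd f g a z -> x = z.
Proof. exact: (nat_pb (nid (pullback f g))). Qed.

Lemma ncomp_nid {C : Category} {F G : Psh C} (s : F ⇒ G) : s ∘ nid F = s.
Proof. exact: nat_eq. Qed.

Lemma tm_eq {C : Category} {Ud U : Psh C} {u : Ud ⇒ U} {G : C} {A : Ty U G}
  (a b : Tm u A) : tm a = tm b -> a = b.
Proof.
case: a b => [a ha] [b hb] /= e; subst b.
by rewrite (proof_irrelevance _ ha hb).
Qed.

(** * Elements of a polynomial as families *)

(** The base change of a fibre along [s]. The triangle is an argument because the
    reindexed type [A'] is often equal to [A ∘ s] only propositionally: for
    instance [yon (b \r g)] and [yon b ∘ ymap g]. *)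
Definition pb_reindex {C : Category} {W Z E B : Psh C} (p : E ⇒ B)
  {A : Z ⇒ B} {A' : W ⇒ B} (s : W ⇒ Z) (h : A ∘ s = A') :
  pullback A' p ⇒ pullback A p.
Proof.
apply: (pb_pair (s := s ∘ pb_fst A' p) (t := pb_snd A' p)).
abstract by rewrite ncompA h pb_comm.
Defined.

(** The second half [f_2] of the pair [(f_1, f_2)] that describes a map
    [y a -> P_p X]. The first half [A] is a parameter, equal to the base of [x]
    by [h], so that families of elements whose bases are only provably equal
    still have the same type. *)
Definition family {C : Category} {E B X : Psh C} {p : E ⇒ B} {a : C}
  (x : poly p X a) {A : y a ⇒ B} (h : yon (projT1 x) = A) :
  pullback A p ⇒ X :=
  prd_snd E X ∘ ohom (projT2 x) ∘
    pb_reindex p (eq_trans (ncomp_nid (yon (projT1 x))) h).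

Lemma yon_unyon_nid {C : Category} {B : Psh C} {a : C} (A : y a ⇒ B) :
  A ∘ nid (y a) = yon (unyon A).
Proof. by rewrite unyonK ncomp_nid. Qed.

Definition poly_of_family {C : Category} {E B X : Psh C} (p : E ⇒ B) {a : C}
  (A : y a ⇒ B) (k : pullback A p ⇒ X) : poly p X a.
Proof.
exists (unyon A).
exists (prd_pair (pb_snd (yon (unyon A)) p)
  (k ∘ pb_reindex p (yon_unyon_nid A))).
abstract exact: nat_eq.
Defined.

Lemma family_poly_of_family {C : Category} {E B X : Psh C} (p : E ⇒ B) {a : C}
  (A : y a ⇒ B) (k : pullback A p ⇒ X) h :
  family (x := poly_of_family k) (A := A) h = k.
Proof. by apply: nat_eq => c w; apply: (nat_pb k). Qed.

Lemma poly_eq_of_family {C : Category} {E B X : Psh C} {p : E ⇒ B} {a : C}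
  (x z : poly p X a) (A : y a ⇒ B) h h' :
  family (x := x) (A := A) h = family (x := z) h' -> x = z.
Proof.
move=> e; apply: push_ob_eq.
  by rewrite -(yonK (projT1 x)) h -h' yonK.
move=> c f w k k'.
rewrite [LHS]surjective_pairing [RHS]surjective_pairing.
apply: (f_equal2 (@pair _ _)).
- by rewrite [LHS](nat_app (ohom_tri (projT2 x)))
    [RHS](nat_app (ohom_tri (projT2 z))).
- have k1 : A c f = p c w by rewrite -h; exact: k.
  have := nat_app e (exist _ (f, w) k1 : pullback A p c).
  rewrite /= => {}e.
  apply: eq_trans (eq_trans _ e) _; congr snd.
  + exact: (nat_pb (projT2 x)).
  + exact: (nat_pb (projT2 z)).
Qed.

Lemma family_restr {C : Category} {E B X : Psh C} {p : E ⇒ B} {a c : C}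
  (x : poly p X a) (g : Hom c a) {A : y a ⇒ B} {A' : y c ⇒ B}
  (h : yon (projT1 x) = A) (hg : A ∘ ymap g = A') h' :
  family (x := x \r g) (A := A') h' = family h ∘ pb_reindex p hg.
Proof.
apply: nat_eq => d w /=; congr snd; exact: (nat_pb (projT2 x)).
Qed.

(** Naturality in the context of the correspondence between elements and
    families: it turns naturality of a section into stability of fillers. *)
Lemma poly_of_family_restr {C : Category} {E B X : Psh C} {p : E ⇒ B} {a c : C}
  (g : Hom c a) {A : y a ⇒ B} {A' : y c ⇒ B} (hg : A ∘ ymap g = A')
  (k : pullback A p ⇒ X) :
  poly_of_family (k ∘ pb_reindex p hg) = poly_of_family k \r g.
Proof.
have h : yon (unyon A \r g) = A'.
  by apply: nat_eq => d w; rewrite -hg /= -!nat_ax /= comp_idl.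
have h1 : yon (unyon A') = A' by exact: unyonK.
apply: (poly_eq_of_family (x := poly_of_family (k ∘ pb_reindex p hg))
  (z := poly_of_family k \r g) (h := h1) (h' := h)).
rewrite family_poly_of_family (family_restr (x := poly_of_family k) (unyonK A)).
by rewrite family_poly_of_family.
Qed.

Lemma family_poly_map {C : Category} {E B X Z : Psh C} {p : E ⇒ B} {a : C}
  (f : X ⇒ Z) (x : poly p X a) {A : y a ⇒ B} (h : yon (projT1 x) = A) h' :
  family (x := poly_map p f a x) (A := A) h' = f ∘ family h.
Proof.
apply: nat_eq => d w /=; congr (f d (snd _)); exact: (nat_pb (projT2 x)).
Qed.

Lemma family_poly_restrict {C : Category} {E F B X : Psh C} {p : E ⇒ B} {q : F ⇒ B}
  {rho : E ⇒ F} (e : q ∘ rho = p) {a : C} (x : poly q X a) {A : y a ⇒ B}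
  (h : yon (projT1 x) = A) h' :
  family (x := poly_restrict e X a x) (A := A) h' = family h ∘ fibre_map e (over A).
Proof.
apply: nat_eq => d w /=; congr snd; exact: (nat_pb (projT2 x)).
Qed.

(** * Sections of the comparison map as stable diagonal fillers *)

(** A filler is chosen for each commuting square over each generalised element
    [A] of [B], compatibly with reindexing. Stability quantifies over every
    [A'] equal to [A ∘ ymap g] and every proof of commutation, which avoids
    transport when a type is reindexed. *)
Record stable_filler {C : Category} {E F B X Z : Psh C} {p : E ⇒ B} {q : F ⇒ B}
  {rho : E ⇒ F} (e : q ∘ rho = p) (f : X ⇒ Z) := {
  fill : forall (a : C) (A : y a ⇒ B) (k : pullback A q ⇒ Z)
    (c : pullback A p ⇒ X), f ∘ c = k ∘ fibre_map e (over A) ->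
    pullback A q ⇒ X;
  fill_lower : forall a A k c h, f ∘ @fill a A k c h = k;
  fill_upper : forall a A k c h, @fill a A k c h ∘ fibre_map e (over A) = c;
  fill_stable : forall a A k c h d (g : Hom d a) A' (hg : A ∘ ymap g = A') h',
    @fill d A' (k ∘ pb_reindex q hg) (c ∘ pb_reindex p hg) h'
      = @fill a A k c h ∘ pb_reindex q hg
}.

Lemma fill_eq {C : Category} {E F B X Z : Psh C} {p : E ⇒ B} {q : F ⇒ B}
  {rho : E ⇒ F} {e : q ∘ rho = p} {f : X ⇒ Z} (S : stable_filler e f) {a : C}
  (A : y a ⇒ B) (k k' : pullback A q ⇒ Z) (c c' : pullback A p ⇒ X) h h' :
  k = k' -> c = c' -> fill S (k := k) (c := c) h = fill S (k := k') (c := c') h'.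
Proof. by move=> ? ?; subst k' c'; rewrite (proof_irrelevance _ h h'). Qed.

Lemma reindex_comm {C : Category} {E F B X Z : Psh C} {p : E ⇒ B}
  {q : F ⇒ B} {rho : E ⇒ F} (e : q ∘ rho = p) (f : X ⇒ Z) {a d : C}
  {A : y a ⇒ B} {k : pullback A q ⇒ Z} {c : pullback A p ⇒ X}
  (h : f ∘ c = k ∘ fibre_map e (over A)) {g : Hom d a} {A' : y d ⇒ B}
  (hg : A ∘ ymap g = A') :
  f ∘ (c ∘ pb_reindex p hg) = k ∘ pb_reindex q hg ∘ fibre_map e (over A').
Proof.
rewrite ncompA h; apply: nat_eq => b w; exact: (nat_pb k).
Qed.

Lemma square_elem_pf {C : Category} {E F B X Z : Psh C} {p : E ⇒ B}
  {q : F ⇒ B} {rho : E ⇒ F} (e : q ∘ rho = p) (f : X ⇒ Z) {a : C}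
  {A : y a ⇒ B} {k : pullback A q ⇒ Z} {c : pullback A p ⇒ X}
  (h : f ∘ c = k ∘ fibre_map e (over A)) :
  poly_restrict e Z a (poly_of_family k) = poly_map p f a (poly_of_family c).
Proof.
apply: (poly_eq_of_family (A := A)); try exact: unyonK.
move=> h1 h2.
rewrite (family_poly_restrict (x := poly_of_family k) (unyonK A)).
rewrite (family_poly_map (x := poly_of_family c) (unyonK A)).
by rewrite !family_poly_of_family.
Qed.

(** The point of the pullback of the comparison square that a commuting square
    of families denotes. *)
Definition square_elem {C : Category} {E F B X Z : Psh C} {p : E ⇒ B}
  {q : F ⇒ B} {rho : E ⇒ F} (e : q ∘ rho = p) (f : X ⇒ Z) {a : C}
  {A : y a ⇒ B} {k : pullback A q ⇒ Z} {c : pullback A p ⇒ X}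
  (h : f ∘ c = k ∘ fibre_map e (over A)) :
  pullback (poly_restrict e Z) (poly_map p f) a :=
  exist _ (poly_of_family k, poly_of_family c) (square_elem_pf h).

(** The section applied to the point denoted by a square is an element of
    [P_q X] over the same base; its family is the filler. The two triangles say
    that the section is a section, and stability that it is natural. *)
Lemma stable_filler_of_weak_pullback {C : Category} {E F B X Z : Psh C}
  {p : E ⇒ B} {q : F ⇒ B} {rho : E ⇒ F} (e : q ∘ rho = p) (f : X ⇒ Z) :
  weak_pullback_structure (poly_restrict_nat e f) -> stable_filler e f.
Proof.
case=> j jK.
have lower a w : poly_map q f a (j a w) = fst (proj1_sig w).
  exact: (f_equal (fun v => fst (proj1_sig v)) (nat_app jK w)).
have upper a w : poly_restrict e X a (j a w) = snd (proj1_sig w).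
  exact: (f_equal (fun v => snd (proj1_sig v)) (nat_app jK w)).
have base a (A : y a ⇒ B) (k : pullback A q ⇒ Z) (c : pullback A p ⇒ X)
    (h : f ∘ c = k ∘ fibre_map e (over A)) :
    yon (projT1 (j a (square_elem h))) = A.
  rewrite -[RHS]unyonK; congr yon.
  exact: (f_equal (@projT1 _ _) (lower a (square_elem h))).
exists (fun a A k c h => family (base a A k c h)).
- move=> a A k c h.
  rewrite -(family_poly_map (base a A k c h) (base a A k c h)).
  move: (base a A k c h : yon (projT1 (poly_map q f a _)) = A).
  rewrite lower; exact: family_poly_of_family.
- move=> a A k c h.
  rewrite -(family_poly_restrict (base a A k c h) (base a A k c h)).
  move: (base a A k c h : yon (projT1 (poly_restrict e X a _)) = A).
  rewrite upper; exact: family_poly_of_family.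
- move=> a A k c h d g A' hg h' /=.
  have E1 : square_elem h' = square_elem h \r g.
    by apply: pb_eq; exact: poly_of_family_restr.
  have E2 : j d (square_elem h') = j a (square_elem h) \r g.
    by rewrite E1 nat_ax.
  move: (base d A' _ _ h'); rewrite E2 => h1.
  exact: (family_restr (x := j a _) (base a A k c h)).
Qed.

(** Conversely to [square_elem], a point of the pullback of the comparison square
    denotes a commuting square of families. *)
Lemma square_comm {C : Category} {E F B X Z : Psh C}
  {p : E ⇒ B} {q : F ⇒ B} {rho : E ⇒ F} (e : q ∘ rho = p) (f : X ⇒ Z) {a : C}
  (w : pullback (poly_restrict e Z) (poly_map p f) a) {A : y a ⇒ B}
  (h1 : yon (projT1 (fst (proj1_sig w))) = A)
  (h2 : yon (projT1 (snd (proj1_sig w))) = A) :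
  f ∘ family h2 = family h1 ∘ fibre_map e (over A).
Proof.
rewrite -(family_poly_map h2 h2) -(family_poly_restrict h1 h1).
move: (h1 : yon (projT1 (poly_restrict e Z a _)) = A).
move: (h2 : yon (projT1 (poly_map p f a _)) = A).
by rewrite (proj2_sig w) => k1 k2; rewrite (proof_irrelevance _ k1 k2).
Qed.

Lemma square_base {C : Category} {E F B X Z : Psh C}
  {p : E ⇒ B} {q : F ⇒ B} {rho : E ⇒ F} {e : q ∘ rho = p} {f : X ⇒ Z} {a : C}
  (w : pullback (poly_restrict e Z) (poly_map p f) a) :
  projT1 (snd (proj1_sig w)) = projT1 (fst (proj1_sig w)).
Proof. exact: (eq_sym (f_equal (@projT1 _ _) (proj2_sig w))). Qed.

(** Every point of the pullback is the point denoted by its own square of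
    families, so filling these squares defines a section. *)
Lemma weak_pullback_of_stable_filler {C : Category} {E F B X Z : Psh C}
  {p : E ⇒ B} {q : F ⇒ B} {rho : E ⇒ F} (e : q ∘ rho = p) (f : X ⇒ Z) :
  stable_filler e f -> weak_pullback_structure (poly_restrict_nat e f).
Proof.
move=> S.
pose h1 a (w : pullback (poly_restrict e Z) (poly_map p f) a) :=
  eq_refl (yon (projT1 (fst (proj1_sig w)))).
pose h2 a (w : pullback (poly_restrict e Z) (poly_map p f) a) :=
  f_equal yon (square_base w).
pose j a w : poly q X a :=
  poly_of_family (fill S (square_comm (h1 a w) (h2 a w))).
unshelve refine (exist _ (@Build_Nat _ _ (poly q X) j _) _).
- move=> a c g w; rewrite /j.
  have hg : yon (projT1 (fst (proj1_sig w))) ∘ ymap g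
          = yon (projT1 (fst (proj1_sig (w \r g)))).
    by apply: nat_eq => d x; rewrite /= restr_comp.
  rewrite -(poly_of_family_restr hg).
  rewrite -(fill_stable S _ (reindex_comm (square_comm (h1 a w) (h2 a w)) hg)).
  congr poly_of_family; apply: fill_eq.
  + exact: family_restr.
  + exact: family_restr.
- apply: nat_eq => a w.
  have ej : yon (projT1 (j a w)) = yon (projT1 (fst (proj1_sig w))).
    exact: unyonK.
  apply: pb_eq.
  + apply: (poly_eq_of_family (x := poly_map q f a (j a w)) (h := ej)
      (h' := h1 a w)).
    by rewrite (family_poly_map ej) family_poly_of_family fill_lower.
  + apply: (poly_eq_of_family (x := poly_restrict e X a (j a w)) (h := ej)
      (h' := h2 a w)).
    by rewrite (family_poly_restrict ej) family_poly_of_family fill_upper.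
Qed.

(** * Substitutions into extended contexts *)

(** The variant of [sub_pair] for an element [a] of [Ud] in place of a term. It
    lets substitutions be compared without casts between the types of terms. *)
Definition ext_mk {C : Category} {Ud U : Psh C} {u : Ud ⇒ U}
  (X : context_extension u) {D G : C} {A : Ty U G} (s : Hom D G) (a : Ud D)
  (h : u D a = A D s) : Hom D (ext X A).
Proof.
apply: (@sub_pair _ _ _ u X D G A s {| tm := yon a; tm_ty := _ |}).
abstract by apply: nat_eq => c f; rewrite /= nat_ax h nat_ax.
Defined.

Lemma proj_ext_mk {C : Category} {Ud U : Psh C} {u : Ud ⇒ U}
  (X : context_extension u) {D G : C} {A : Ty U G} (s : Hom D G) (a : Ud D)
  (h : u D a = A D s) : proj X A \c ext_mk X h = s.
Proof. exact: proj_sub_pair. Qed.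

Lemma var_ext_mk {C : Category} {Ud U : Psh C} {u : Ud ⇒ U}
  (X : context_extension u) {D G : C} {A : Ty U G} (s : Hom D G) (a : Ud D)
  (h : u D a = A D s) : tm (var X A) D (ext_mk X h) = a.
Proof.
have := nat_app (@var_sub_pair _ _ _ u X D G A s
  {| tm := yon a; tm_ty := ext_mk_subproof h |}) (idc D).
by rewrite /= comp_idr restr_id.
Qed.

Lemma ext_ext {C : Category} {Ud U : Psh C} {u : Ud ⇒ U}
  (X : context_extension u) {D G : C} {A : Ty U G} (f g : Hom D (ext X A)) :
  proj X A \c f = proj X A \c g ->
  tm (var X A) D f = tm (var X A) D g -> f = g.
Proof.
move=> e1 e2; apply: (ext_hom_eq e1); apply: nat_eq => c h.
by rewrite [LHS](nat_ax (tm (var X A)) h f) [RHS](nat_ax (tm (var X A)) h g) e2.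
Qed.

Lemma ty_var {C : Category} {Ud U : Psh C} {u : Ud ⇒ U}
  (X : context_extension u) {D G : C} {A : Ty U G} (f : Hom D (ext X A)) :
  u D (tm (var X A) D f) = A D (proj X A \c f).
Proof. exact: (nat_app (tm_ty (var X A)) f). Qed.

Lemma fst_ext_to {C : Category} {Ud U : Psh C} {u : Ud ⇒ U}
  (X : context_extension u) {G : C} (A : Ty U G) :
  pb_fst A u ∘ ext_to (X G A) = ymap (proj X A).
Proof. by rewrite /proj ymap_unyon. Qed.

(** The generic pair of terms of a common type: every element of
    [pullback u u] is an instance of it ([vars2_ext2_mk]). *)
Definition vars2 {C : Category} {Ud U : Psh C} {u : Ud ⇒ U}
  (X : context_extension u) {G : C} (A : Ty U G) : y (ext2 X A) ⇒ pullback u u.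
Proof.
apply: (pb_pair (s := tm (var X A) ∘ ymap (proj X A.[proj X A]))
                (t := tm (var X A.[proj X A]))).
abstract by rewrite ncompA !tm_ty.
Defined.

Lemma ext2_ext {C : Category} {Ud U : Psh C} {u : Ud ⇒ U}
  (X : context_extension u) {D G : C} {A : Ty U G} (f g : Hom D (ext2 X A)) :
  proj X A \c (proj X A.[proj X A] \c f) =
    proj X A \c (proj X A.[proj X A] \c g) ->
  vars2 X A D f = vars2 X A D g -> f = g.
Proof.
move=> e1 e2; apply: ext_ext.
- apply: (ext_ext e1); exact: (f_equal (fun w => fst (proj1_sig w)) e2).
- exact: (f_equal (fun w => snd (proj1_sig w)) e2).
Qed.

Definition ext2_mk {C : Category} {Ud U : Psh C} {u : Ud ⇒ U}
  (X : context_extension u) {D G : C} {A : Ty U G} (s : Hom D G)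
  (w : pullback u u D) (h : u D (pb_fst u u D w) = A D s) : Hom D (ext2 X A).
Proof.
apply: (@ext_mk _ _ _ u X D _ _ (ext_mk X h) (pb_snd u u D w)).
abstract by rewrite -[LHS](nat_app (pb_comm u u) w)
  [RHS](f_equal (A D) (proj_ext_mk X h)).
Defined.

Lemma proj_ext2_mk {C : Category} {Ud U : Psh C} {u : Ud ⇒ U}
  (X : context_extension u) {D G : C} {A : Ty U G} (s : Hom D G)
  (w : pullback u u D) (h : u D (pb_fst u u D w) = A D s) :
  proj X A \c (proj X A.[proj X A] \c ext2_mk X h) = s.
Proof. by rewrite !proj_ext_mk. Qed.

Lemma vars2_ext2_mk {C : Category} {Ud U : Psh C} {u : Ud ⇒ U}
  (X : context_extension u) {D G : C} {A : Ty U G} (s : Hom D G)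
  (w : pullback u u D) (h : u D (pb_fst u u D w) = A D s) :
  vars2 X A D (ext2_mk X h) = w.
Proof.
apply: pb_eq; last exact: var_ext_mk.
by rewrite /= [_ \c ext2_mk X h]proj_ext_mk; exact: (var_ext_mk X h).
Qed.

Lemma ext_mk_eq {C : Category} {Ud U : Psh C} {u : Ud ⇒ U}
  (X : context_extension u) {D G : C} {A : Ty U G} (s s' : Hom D G)
  (a a' : Ud D) (h : u D a = A D s) (h' : u D a' = A D s') :
  s = s' -> a = a' -> ext_mk X h = ext_mk X h'.
Proof. by move=> es ea; apply: ext_ext; rewrite ?proj_ext_mk ?var_ext_mk. Qed.

Lemma restr_ty {C : Category} {Ud U : Psh C} {u : Ud ⇒ U} {D G : C}
  {A : Ty U G} {s : Hom D G} {a : Ud D} {E : C} (f : Hom E D) :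
  u D a = A D s -> u E (a \r f) = A E (s \c f).
Proof. by move=> h; rewrite nat_ax h [RHS](nat_ax A f s). Qed.

Lemma ext_mk_comp {C : Category} {Ud U : Psh C} {u : Ud ⇒ U}
  (X : context_extension u) {D G : C} {A : Ty U G} (s : Hom D G) (a : Ud D)
  (h : u D a = A D s) {E : C} (f : Hom E D) :
  ext_mk X h \c f = ext_mk X (restr_ty f h).
Proof.
apply: ext_ext; first by rewrite comp_assoc !proj_ext_mk.
by rewrite [LHS](nat_ax (tm (var X A)) f (ext_mk X h)) !var_ext_mk.
Qed.

Lemma vars2_lift2 {C : Category} {Ud U : Psh C} {u : Ud ⇒ U}
  (X : context_extension u) {D G : C} (s : Hom D G) (A : Ty U G) :
  vars2 X A ∘ ymap (lift2 X s A) = vars2 X A.[s].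
Proof.
apply: nat_eq => c f; apply: pb_eq.
- rewrite /= comp_assoc [_ \c lift2 X s A](proj_lift X (lift2_ty X s A)).
  by rewrite -comp_assoc; exact: (nat_app (var_lift X (eq_refl A.[s]))).
- exact: (nat_app (var_lift X (lift2_ty X s A))).
Qed.

Lemma vars2_diag {C : Category} {Ud U : Psh C} {u : Ud ⇒ U}
  (X : context_extension u) {G : C} (A : Ty U G) :
  vars2 X A ∘ ymap (diag X A) = diagonal u ∘ tm (var X A).
Proof.
apply: nat_eq => c f; apply: pb_eq; last exact: (nat_app (var_diag X A)).
by rewrite /= !comp_assoc proj_diag comp_idl.
Qed.

(** * Formation and introduction as maps of presheaves *)

(** The rules and the maps interpret the same identity types. It suffices to
    compare them at the variables, of which all other instances are
    substitutions. *)
Record agree {C : Category} {Ud U : Psh C} {u : Ud ⇒ U}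
  {X : context_extension u} {F : Id_formation X} (I : Id_introduction F)
  (Id : pullback u u ⇒ U) (i : Ud ⇒ Ud) : Prop := {
  agree_Id : forall (G : C) (A : Ty U G), Idt F A = Id ∘ vars2 X A;
  agree_i : forall (G : C) (A : Ty U G), tm (refl I A) = i ∘ tm (var X A)
}.

(** Stability under substitution is automatic here, since substitution is
    composition on the other side of [Id] and [i]. *)
Lemma rules_of_maps {C : Category} {Ud U : Psh C} {u : Ud ⇒ U}
  (X : context_extension u) {Id : pullback u u ⇒ U} {i : Ud ⇒ Ud}
  (e : u ∘ i = Id ∘ diagonal u) :
  exists (F : Id_formation X) (I : Id_introduction F), agree I Id i.
Proof.
unshelve refine (ex_intro _
  {| Idt := fun G A => Id ∘ vars2 X A : Ty U (ext2 X A) |} _).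
  by move=> D G s A; rewrite /ty_sub -ncompA vars2_lift2.
unshelve refine (ex_intro _ {| refl := fun G A =>
  {| tm := i ∘ tm (var X A); tm_ty := _ |} |} _).
- by rewrite /= /ty_sub -ncompA vars2_diag !ncompA e.
- move=> D G s A.
  by rewrite /= -ncompA [_ ∘ ymap _](var_lift X (eq_refl A.[s])).
- by split.
Qed.

Lemma ty_yon {C : Category} {Ud U : Psh C} {u : Ud ⇒ U} {D : C} (a : Ud D) :
  u D a = yon (u D a) D (idc D).
Proof. exact: (eq_sym (restr_id _)). Qed.

(** Since [Id_A] commutes with substitution, its instance at a pair of terms of
    type [A[s]] depends on the type [A[s]] only, not on [A] and [s]. This is what
    makes the operation on pairs induced by the rule well defined and natural. *)
Lemma Idt_local {C : Category} {Ud U : Psh C} {u : Ud ⇒ U}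
  {X : context_extension u} (F : Id_formation X) {D G : C} {A : Ty U G}
  (s : Hom D G) (w : pullback u u D) {B : Ty U D}
  (h : u D (pb_fst u u D w) = A D s)
  (k : u D (pb_fst u u D w) = B D (idc D)) :
  Idt F A D (ext2_mk X h) = Idt F B D (ext2_mk X k).
Proof.
(* Both types have the same value at the identity: the Yoneda lemma. *)
have e : B = A.[s].
  by rewrite -(unyonK A.[s]) -(unyonK B) /unyon -k h /= comp_idr.
subst B; rewrite Idt_sub /=; congr (Idt F A D).
apply: ext2_ext.
- rewrite proj_ext2_mk (comp_assoc (proj X A.[proj X A])) /lift2.
  rewrite (proj_lift X (lift2_ty X s A)) -comp_assoc.
  rewrite (comp_assoc (proj X A)) (proj_lift X (eq_refl A.[s])).
  by rewrite -comp_assoc proj_ext2_mk comp_idr.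
- by rewrite [RHS](nat_app (vars2_lift2 X s A)) !vars2_ext2_mk.
Qed.

(** The analogue of [Idt_local] for the introduction rule. *)
Lemma refl_local {C : Category} {Ud U : Psh C} {u : Ud ⇒ U}
  {X : context_extension u} {F : Id_formation X} (I : Id_introduction F)
  {D G : C} {A : Ty U G} (s : Hom D G) (a : Ud D) {B : Ty U D}
  (h : u D a = A D s) (k : u D a = B D (idc D)) :
  tm (refl I A) D (ext_mk X h) = tm (refl I B) D (ext_mk X k).
Proof.
(* Both types have the same value at the identity: the Yoneda lemma. *)
have e : B = A.[s].
  by rewrite -(unyonK A.[s]) -(unyonK B) /unyon -k h /= comp_idr.
subst B; rewrite refl_sub /=; congr (tm (refl I A) D).
apply: ext_ext.
- rewrite proj_ext_mk comp_assoc (proj_lift X (eq_refl A.[s])) -comp_assoc.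
  by rewrite proj_ext_mk comp_idr.
- by rewrite [RHS](nat_app (var_lift X (eq_refl A.[s]))) !var_ext_mk.
Qed.

(** A pair [(a, b)] of elements over [G] has the common type [yon (u a)], and
    [Id] sends it to the instance of the formation rule for that type; [i] is
    defined likewise. By [Idt_local] and [refl_local] the type may be replaced by
    any [A] and [s] with [A[s]] equal to it, which gives both naturality and
    agreement. *)
Lemma maps_of_rules {C : Category} {Ud U : Psh C} {u : Ud ⇒ U}
  {X : context_extension u} {F : Id_formation X} (I : Id_introduction F) :
  exists (i : Ud ⇒ Ud) (Id : pullback u u ⇒ U),
    u ∘ i = Id ∘ diagonal u /\ agree I Id i.
Proof.
pose i a (x : Ud a) : Ud a :=
  tm (refl I (yon (u a x))) a (ext_mk X (ty_yon (u:=u) x)).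
pose Id a (w : pullback u u a) : U a :=
  Idt F (yon (u a (pb_fst u u a w))) a
    (ext2_mk X (w := w) (ty_yon (u:=u) (pb_fst u u a w))).
have iE D G (A : Ty U G) (f : Hom D (ext X A)) :
    tm (refl I A) D f = i D (tm (var X A) D f).
  rewrite /i -(refl_local I (ty_var f)); congr (tm (refl I A) D).
  by apply: ext_ext; rewrite ?proj_ext_mk ?var_ext_mk.
have ty2 D G (A : Ty U G) (f : Hom D (ext2 X A)) :
    u D (pb_fst u u D (vars2 X A D f))
      = A D (proj X A \c (proj X A.[proj X A] \c f)).
  exact: ty_var.
have IdE D G (A : Ty U G) (f : Hom D (ext2 X A)) :
    Idt F A D f = Id D (vars2 X A D f).
  rewrite /Id -(Idt_local F (ty2 _ _ _ f)); congr (Idt F A D).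
  by apply: ext2_ext; rewrite ?proj_ext2_mk ?vars2_ext2_mk.
unshelve refine (ex_intro _ (@Build_Nat _ _ _ i _) _).
  move=> a b f x; rewrite {2}/i -nat_ax iE nat_ax; congr (i b (_ \r f)).
  by rewrite var_ext_mk.
unshelve refine (ex_intro _ (@Build_Nat _ _ _ Id _) _).
  move=> a b f w; rewrite {2}/Id -nat_ax IdE nat_ax; congr (Id b (_ \r f)).
  by rewrite vars2_ext2_mk.
split; last by split=> G A; apply: nat_eq => D f; [exact: IdE|exact: iE].
apply: nat_eq => a x; rewrite /= {1}/i.
rewrite [LHS](nat_app (tm_ty (refl I (yon (u a x))))).
rewrite [LHS]IdE; congr (Id a _).
rewrite [LHS](nat_app (vars2_diag X _)).
by apply: pb_eq; exact: var_ext_mk.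
Qed.

(** * Elimination as stable diagonal fillers *)

(** The variables [x, y : A] and [z : Id_A(x,y)] exhibit their context as the
    representing object of the fibre of [Iq Id] at [A]. Because of [agree_Id]
    the type of [z] is an instance of [Id], so that the triple lies in
    [Ipb Id]. *)
Definition vars3 {C : Category} {Ud U : Psh C} {u : Ud ⇒ U}
  {X : context_extension u} {F : Id_formation X} {I : Id_introduction F}
  {Id : pullback u u ⇒ U} {i : Ud ⇒ Ud} (H : agree I Id i)
  {G : C} (A : Ty U G) : y (ext3 F A) ⇒ pullback A (Iq Id).
Proof.
unshelve refine (pb_pair
  (s := ymap (proj X A \c (proj X A.[proj X A] \c proj X (Idt F A))))
  (t := pb_pair (s := vars2 X A ∘ ymap (proj X (Idt F A)))
          (t := tm (var X (Idt F A))) _) _).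
- abstract by rewrite tm_ty /ty_sub (agree_Id H) ncompA.
- abstract by rewrite !ymap_comp; apply: nat_eq => c f /=; rewrite -ty_var.
Defined.

Definition vars3_inv {C : Category} {Ud U : Psh C} {u : Ud ⇒ U}
  {X : context_extension u} {F : Id_formation X} {I : Id_introduction F}
  {Id : pullback u u ⇒ U} {i : Ud ⇒ Ud} (H : agree I Id i)
  {G : C} (A : Ty U G) : pullback A (Iq Id) ⇒ y (ext3 F A).
Proof.
unshelve refine {| nat_ap D w := ext_mk X
  (s := ext2_mk X (s := pb_fst A (Iq Id) D w)
    (w := pb_fst Id u D (pb_snd A (Iq Id) D w))
    (eq_sym (nat_app (pb_comm A (Iq Id)) w)))
  (a := pb_snd Id u D (pb_snd A (Iq Id) D w)) _ : y (ext3 F A) D |}.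
- abstract (rewrite (agree_Id H);
    apply: eq_trans (eq_sym (nat_app (pb_comm Id u) (pb_snd A (Iq Id) D w))) _;
    apply: (f_equal (Id D)); exact: (eq_sym (vars2_ext2_mk _ _))).
- abstract (move=> D E f w; rewrite /= ext_mk_comp; apply: ext_mk_eq => //;
    rewrite /ext2_mk ext_mk_comp; apply: ext_mk_eq => //;
    by rewrite ext_mk_comp; apply: ext_mk_eq).
Defined.

Lemma vars3K {C : Category} {Ud U : Psh C} {u : Ud ⇒ U}
  {X : context_extension u} {F : Id_formation X} {I : Id_introduction F}
  {Id : pullback u u ⇒ U} {i : Ud ⇒ Ud} (H : agree I Id i)
  {G : C} (A : Ty U G) : vars3_inv H A ∘ vars3 H A = nid (y (ext3 F A)).
Proof.
apply: nat_eq => D f; apply: ext_ext; last exact: var_ext_mk.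
rewrite [LHS]proj_ext_mk; apply: ext2_ext; last exact: vars2_ext2_mk.
by rewrite proj_ext2_mk /= -!comp_assoc.
Qed.

Lemma vars3_invK {C : Category} {Ud U : Psh C} {u : Ud ⇒ U}
  {X : context_extension u} {F : Id_formation X} {I : Id_introduction F}
  {Id : pullback u u ⇒ U} {i : Ud ⇒ Ud} (H : agree I Id i)
  {G : C} (A : Ty U G) : vars3 H A ∘ vars3_inv H A = nid (pullback A (Iq Id)).
Proof.
apply: nat_eq => D w; apply: pb_eq.
  by rewrite /= -!comp_assoc proj_ext_mk proj_ext2_mk.
apply: pb_eq; last exact: var_ext_mk.
rewrite /= [_ \c ext_mk X _]proj_ext_mk; exact: vars2_ext2_mk.
Qed.

Lemma vars3_lift3 {C : Category} {Ud U : Psh C} {u : Ud ⇒ U}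
  {X : context_extension u} {F : Id_formation X} {I : Id_introduction F}
  {Id : pullback u u ⇒ U} {i : Ud ⇒ Ud} (H : agree I Id i)
  {D G : C} (s : Hom D G) {A : Ty U G} (hs : A ∘ ymap s = A.[s]) :
  vars3 H A ∘ ymap (lift3 F s A) = pb_reindex (Iq Id) hs ∘ vars3 H A.[s].
Proof.
(* The three weakenings of [s] commute with the projections, one by one. *)
have e3 := proj_lift X (Idt_sub F s A).
have e2 := proj_lift X (lift2_ty X s A).
have e1 := proj_lift X (eq_refl A.[s]).
have e : proj X A \c (proj X A.[proj X A] \c proj X (Idt F A)) \c lift3 F s A
    = s \c (proj X A.[s] \c (proj X A.[s].[proj X A.[s]]
              \c proj X (Idt F A.[s]))).
  rewrite -!comp_assoc [proj X (Idt F A) \c _]e3.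
  rewrite (comp_assoc (proj X A.[proj X A])) [_ \c lift2 X s A]e2 -comp_assoc.
  by rewrite (comp_assoc (proj X A)) e1 -comp_assoc.
apply: nat_eq => E f; apply: pb_eq.
  rewrite /= (comp_assoc _ _ f) e; exact: (eq_sym (comp_assoc _ _ _)).
apply: pb_eq; last exact: (nat_app (var_lift X (Idt_sub F s A))).
rewrite /= (comp_assoc _ _ f) [_ \c lift3 F s A]e3 -comp_assoc.
exact: (nat_app (vars2_lift2 X s A)).
Qed.

(** The link between the premise of elimination, which is stated along
    [(x, x, i x)], and the left edge of the squares to be filled. Both
    components of [agree] enter: the first through [vars3], the second for the
    last coordinate. *)
Lemma vars3_rho {C : Category} {Ud U : Psh C} {u : Ud ⇒ U}
  {X : context_extension u} {F : Id_formation X} {I : Id_introduction F}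
  {Id : pullback u u ⇒ U} {i : Ud ⇒ Ud} (H : agree I Id i)
  (e : u ∘ i = Id ∘ diagonal u) {G : C} (A : Ty U G) :
  vars3 H A ∘ ymap (rho_sub I A) =
    fibre_map (Iq_rho e) (over A) ∘ ext_to (X G A).
Proof.
apply: nat_eq => D f; apply: pb_eq.
  rewrite [RHS](nat_app (fst_ext_to X A) f) /= comp_assoc.
  by rewrite -!comp_assoc (comp_assoc _ _ f) proj_rho_sub (comp_assoc _ _ f)
    proj_diag comp_idl.
apply: pb_eq; last first.
  by rewrite [LHS](nat_app (var_rho_sub I A)) (agree_i H).
rewrite /= (comp_assoc _ _ f) proj_rho_sub.
exact: (nat_app (vars2_diag X A)).
Qed.

Lemma ext_to_lift1 {C : Category} {Ud U : Psh C} {u : Ud ⇒ U}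
  (X : context_extension u) {D G : C} (s : Hom D G) {A : Ty U G}
  (hs : A ∘ ymap s = A.[s]) :
  ext_to (X G A) ∘ ymap (lift1 X s A) = pb_reindex u hs ∘ ext_to (X D A.[s]).
Proof.
apply: nat_eq => E f; apply: pb_eq.
  rewrite [LHS](nat_app (fst_ext_to X A)).
  rewrite [RHS](f_equal (comp s) (nat_app (fst_ext_to X A.[s]) f)).
  by rewrite /= !comp_assoc (proj_lift X (eq_refl A.[s])).
exact: (nat_app (var_lift X (eq_refl A.[s]))).
Qed.

(** A form of [J_sub] free of the cast in [premise_sub]: only the underlying
    maps of the motives and premises have to be compared. *)
Lemma J_stable {C : Category} {Ud U : Psh C} {u : Ud ⇒ U}
  {X : context_extension u} {F : Id_formation X} {I : Id_introduction F}
  (E : Id_elimination I) {D G : C} (s : Hom D G) {A : Ty U G}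
  {K : Ty U (ext3 F A)} (c : Tm u K.[rho_sub I A])
  {K' : Ty U (ext3 F A.[s])} (c' : Tm u K'.[rho_sub I A.[s]]) :
  K' = K.[lift3 F s A] -> tm c' = tm c ∘ ymap (lift1 X s A) ->
  tm (J E c') = tm (J E c) ∘ ymap (lift3 F s A).
Proof.
move=> eK ec; subst K'; rewrite -J_sub; apply: (f_equal (fun c => tm (J E c)));
exact: tm_eq.
Qed.

Lemma iso_square {C : Category} {F G F' G' : Psh C} {f : F ⇒ G} {g : F' ⇒ G'}
  {a : G ⇒ G'} {b : F ⇒ F'} {a' : G' ⇒ G} {b' : F' ⇒ F} :
  a ∘ f = g ∘ b -> a' ∘ a = nid G -> b ∘ b' = nid F' -> f ∘ b' = a' ∘ g.
Proof.
move=> e ea eb; rewrite -[g]ncomp_nid -eb (ncompA g) -e !ncompA ea.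
exact: nat_eq.
Qed.

Lemma vars3_inv_lift3 {C : Category} {Ud U : Psh C} {u : Ud ⇒ U}
  {X : context_extension u} {F : Id_formation X} {I : Id_introduction F}
  {Id : pullback u u ⇒ U} {i : Ud ⇒ Ud} (H : agree I Id i)
  {D G : C} (s : Hom D G) {A : Ty U G} (hs : A ∘ ymap s = A.[s]) :
  ymap (lift3 F s A) ∘ vars3_inv H A.[s] = vars3_inv H A ∘ pb_reindex (Iq Id) hs.
Proof. exact: (iso_square (vars3_lift3 H hs) (vars3K H _) (vars3_invK H _)). Qed.

Lemma ext_from_lift1 {C : Category} {Ud U : Psh C} {u : Ud ⇒ U}
  (X : context_extension u) {D G : C} (s : Hom D G) {A : Ty U G}
  (hs : A ∘ ymap s = A.[s]) :
  ymap (lift1 X s A) ∘ ext_from (X D A.[s]) = ext_from (X G A) ∘ pb_reindex u hs.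
Proof.
exact: (iso_square (ext_to_lift1 X hs) (ext_toK (X G A)) (ext_fromK (X D A.[s]))).
Qed.

Lemma comp_cancel {C : Category} {F G H : Psh C} {s : F ⇒ G} {t : G ⇒ F}
  (k : G ⇒ H) : s ∘ t = nid G -> k ∘ s ∘ t = k.
Proof. by move=> e; rewrite -ncompA e ncomp_nid. Qed.

(** The commuting squares of families correspond to the motives with a premise
    for the elimination rule; [fill_premise] is the converse passage. *)
Lemma J_premise {C : Category} {Ud U : Psh C} {u : Ud ⇒ U}
  {X : context_extension u} {F : Id_formation X} {I : Id_introduction F}
  {Id : pullback u u ⇒ U} {i : Ud ⇒ Ud} (H : agree I Id i)
  (e : u ∘ i = Id ∘ diagonal u) {G : C} {A : Ty U G}
  {k : pullback A (Iq Id) ⇒ U} {c : pullback A u ⇒ Ud} :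
  u ∘ c = k ∘ fibre_map (Iq_rho e) (over A) ->
  u ∘ (c ∘ ext_to (X G A)) = ty_sub (k ∘ vars3 H A) (rho_sub I A).
Proof. by move=> h; rewrite ncompA h /ty_sub -!ncompA (vars3_rho H e). Qed.

Lemma fill_premise {C : Category} {Ud U : Psh C} {u : Ud ⇒ U}
  {X : context_extension u} {F : Id_formation X} {I : Id_introduction F}
  {Id : pullback u u ⇒ U} {i : Ud ⇒ Ud} (H : agree I Id i)
  (e : u ∘ i = Id ∘ diagonal u) {G : C} {A : Ty U G}
  {K : Ty U (ext3 F A)} (c : Tm u K.[rho_sub I A]) :
  u ∘ (tm c ∘ ext_from (X G A)) =
    K ∘ vars3_inv H A ∘ fibre_map (Iq_rho e) (over A).
Proof.
have <- : fibre_map (Iq_rho e) (over A) ∘ ext_to (X G A) ∘ ext_from (X G A)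
    = fibre_map (Iq_rho e) (over A) by apply: comp_cancel; exact: ext_fromK.
rewrite -(vars3_rho H) !ncompA (comp_cancel K (vars3K H A)) tm_ty //.
Qed.

(** The isomorphisms [ext_to] and [vars3] carry a square to a motive and a
    premise, and the term given by [J] back to a filler. The lower triangle is
    the type of that term, the upper one the computation rule. *)
Lemma stable_filler_of_elimination {C : Category} {Ud U : Psh C} {u : Ud ⇒ U}
  {X : context_extension u} {F : Id_formation X} {I : Id_introduction F}
  {Id : pullback u u ⇒ U} {i : Ud ⇒ Ud} (H : agree I Id i)
  (e : u ∘ i = Id ∘ diagonal u) :
  Id_elimination I -> stable_filler (Iq_rho e) u.
Proof.
move=> E.
exists (fun G A k c h => tm (J E {| tm := c ∘ ext_to (X G A);
                                   tm_ty := J_premise H h |}) ∘ vars3_inv H A).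
- by move=> G A k c h; rewrite ncompA tm_ty (comp_cancel _ (vars3_invK H A)).
- move=> G A k c h /=.
  have <- : fibre_map (Iq_rho e) (over A) ∘ ext_to (X G A) ∘ ext_from (X G A)
    = fibre_map (Iq_rho e) (over A) by apply: comp_cancel; exact: ext_fromK.
  rewrite -(vars3_rho H) !ncompA (comp_cancel _ (vars3K H A)) J_comp /=.
  by apply: comp_cancel; exact: ext_fromK.
- move=> G A k c h D s A' hs h'; subst A'.
  rewrite (J_stable E (s := s) (c := {| tm := c ∘ ext_to (X G A);
                                   tm_ty := J_premise H h |})).
  + by rewrite /ty_sub -!ncompA vars3_lift3.
  + by rewrite /= -!ncompA ext_to_lift1.
  + rewrite -[LHS]ncompA -[RHS]ncompA; apply: f_equal.
    exact: (vars3_inv_lift3 H (eq_refl A.[s])).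
Qed.

(** The same passage in the opposite direction: the lower triangle gives the
    type of the term, the upper one the computation rule, and stability its
    commutation with substitution. *)
Lemma elimination_of_stable_filler {C : Category} {Ud U : Psh C} {u : Ud ⇒ U}
  {X : context_extension u} {F : Id_formation X} {I : Id_introduction F}
  {Id : pullback u u ⇒ U} {i : Ud ⇒ Ud} (H : agree I Id i)
  (e : u ∘ i = Id ∘ diagonal u) :
  stable_filler (Iq_rho e) u -> Id_elimination I.
Proof.
move=> S.
unshelve refine {| J := fun G A K c =>
  {| tm := fill S (fill_premise H e c) ∘ vars3 H A; tm_ty := _ |} |}.
- by rewrite ncompA fill_lower; apply: comp_cancel; exact: vars3K.
- move=> G A K c /=; rewrite -ncompA vars3_rho ncompA fill_upper.
  by apply: comp_cancel; exact: ext_toK.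
- move=> D G s A K c; have hs : A ∘ ymap s = A.[s] by [].
  rewrite [LHS]/= [RHS]/= -[RHS]ncompA (vars3_lift3 H hs) [RHS]ncompA.
  rewrite -(fill_stable S _ (reindex_comm (fill_premise H e c) hs)).
  apply: (f_equal (fun t => t ∘ vars3 H A.[s])); apply: fill_eq.
  + by rewrite /ty_sub -!ncompA (vars3_inv_lift3 H hs).
  + by rewrite /= -!ncompA (ext_from_lift1 X hs).
Qed.

Theorem proposition12 (C : Category) (U Ud : Psh C) (u : Ud ⇒ U)
  (hu : representable u) (X : context_extension u) :
  satisfies_Id_rules u X <-> models_Id u.
Proof.
split.
- case=> [F [I [E]]]; have [i [Id [e H]]] := maps_of_rules I.
  exists i, Id, e; constructor; apply: weak_pullback_of_stable_filler.
  exact: (stable_filler_of_elimination H e E).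
- case=> [i [Id [e [J]]]]; have [F [I H]] := rules_of_maps X e.
  exists F, I; constructor; apply: (elimination_of_stable_filler H (e := e)).
  exact: stable_filler_of_weak_pullback J.
Qed.
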